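(* Let $I\subsetneq P=\Bbbk[x_1,\dots,x_n]$ be a non-zero proper homogeneous ideal, $H$ a homogeneous Pommaret basis of $I$ for a class respecting term order, and $d=\min_{h\in H}\mathrm{cls}\,h$. Then the depth of $A=P/I$ is $\mathrm{depth}\,A=d-1$.
   Context: $\Bbbk$ is a field. The class of $\mu\in\mathbb{N}_0^n$ is $\mathrm{cls}\,\mu=\min\{i\mid\mu_i\ne0\}$, with $\mathrm{cls}\,0=n$; for $f\neq0$, $\mathrm{cls}\,f$ is the class of the leading exponent $\mathrm{le}_\prec f$. A term order $\prec$ is class respecting if for multi indices with $|\mu|=|\nu|$ (same total degree) $\mathrm{cls}\,\mu<\mathrm{cls}\,\nu$ implies $\mu\prec\nu$. The Pommaret cone of $\mu$ is $C_P(\mu)=\{\mu+\rho\mid\rho\in\mathbb{N}_0^n,\ \rho_j=0\text{ for all }j>\mathrm{cls}\,\mu\}$. A Pommaret basis of $I$ for $\prec$ is a finite set $H\subset I\setminus\{0\}$ with pairwise distinct leading exponents such that $\mathrm{le}_\prec I=\{\mathrm{le}_\prec f\mid0\ne f\in I\}$ is the disjoint union of the cones $C_P(\mathrm{le}_\prec h)$, $h\in H$; it is homogeneous if all its elements are. The depth of a finitely generated graded $P$-module is the maximal length of a regular sequence on it consisting of homogeneous polynomials of positive degree (equivalently, its depth with respect to $\langle x_1,\dots,x_n\rangle$). *)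

(* Defs.v *)
From HB Require Import structures.
From mathcomp Require Import all_boot all_order all_algebra.
From mathcomp.multinomials Require Import mpoly.

Set Implicit Arguments.
Unset Strict Implicit.
Unset Printing Implicit Defensive.

Import GRing.Theory.
Local Open Scope ring_scope.
Local Open Scope quotient_scope.

Section QuotientModule.
Variables (R : comNzRingType) (I : idealr R).

Definition quot_scale (r : R) (a : {ideal_quot I}) : {ideal_quot I} :=
  \pi_{ideal_quot I} r * a.

Fact quot_scaleA r s a :
  quot_scale r (quot_scale s a) = quot_scale (r * s) a.
Proof. by rewrite /quot_scale rmorphM mulrA. Qed.

Fact quot_scale1 : left_id 1 quot_scale.
Proof. by move=> a; rewrite /quot_scale rmorph1 mul1r. Qed.

Fact quot_scaleDr : right_distributive quot_scale +%R.
Proof. by move=> r a b; rewrite /quot_scale mulrDr. Qed.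

Fact quot_scaleDl a : {morph quot_scale^~ a : r s / r + s}.
Proof. by move=> r s; rewrite /quot_scale rmorphD mulrDl. Qed.

HB.instance Definition _ :=
  GRing.Zmodule_isLmodule.Build R {ideal_quot I}
    quot_scaleA quot_scale1 quot_scaleDr quot_scaleDl.

End QuotientModule.

Section RegularSequence.
Variables (R : comNzRingType) (M : lmodType R).

(* m belongs to the submodule (s_0, s_1, ...) M *)
Definition in_seq_mul (s : seq R) (m : M) : Prop :=
  exists c : 'I_(size s) -> M, m = \sum_(i < size s) s`_i *: c i.

(* each s_i is a nonzerodivisor on M / (s_0, ..., s_(i-1)) M, and s M <> M *)
Definition regular_seq (s : seq R) : Prop :=
  (forall i, (i < size s)%N ->
     forall m : M, in_seq_mul (take i s) (s`_i *: m) ->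
                   in_seq_mul (take i s) m) /\
  (exists m : M, ~ in_seq_mul s m).

End RegularSequence.

Section Depth.
Variables (k : fieldType) (n : nat).
Local Notation P := {mpoly k[n]}.

Definition homog_posdeg (f : P) : Prop :=
  exists2 d : nat, (0 < d)%N & f \is d.-homog.

Definition homog_regular_seq (M : lmodType P) (s : seq P) : Prop :=
  regular_seq M s /\ {in s, forall f, homog_posdeg f}.

Definition has_depth (M : lmodType P) (r : nat) : Prop :=
  (exists2 s : seq P, homog_regular_seq M s & size s = r) /\
  (forall s : seq P, homog_regular_seq M s -> (size s <= r)%N).

Definition homog_ideal (I : idealr P) : Prop :=
  forall (f : P) (d : nat), f \in I -> pihomog mdeg d f \in I.

End Depth.

Section Multiindices.
Variable n : nat.
Implicit Types (mu nu rho : 'X_{1..n}).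

(* Variables are indexed by 'I_n, so x_(i+1) is 'X_i and classes range over
   1, ..., n.  Every i.+1 is at most n, so the default n only matters for
   mu = 0. *)
Definition cls mu : nat := \big[minn/n]_(i < n | mu i != 0%N) i.+1.

Definition pommaret_cone mu nu : Prop :=
  exists2 rho, nu = (mu + rho)%MM &
    forall j : 'I_n, (cls mu < j.+1)%N -> rho j = 0%N.

(* ord is the reflexive relation associated with a strict term order. *)
Record term_order (ord : rel 'X_{1..n}) : Prop := TermOrder {
  term_order_refl : reflexive ord;
  term_order_anti : antisymmetric ord;
  term_order_trans : transitive ord;
  term_order_total : total ord;
  term_order_ge0 : forall mu, ord 0%MM mu;
  term_order_add : forall mu nu rho,
    ord mu nu -> ord (mu + rho)%MM (nu + rho)%MM }.

Definition strict_ord (ord : rel 'X_{1..n}) mu nu : bool :=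
  (mu != nu) && ord mu nu.

Definition class_respecting (ord : rel 'X_{1..n}) : Prop :=
  forall mu nu, mdeg mu = mdeg nu -> (cls mu < cls nu)%N ->
    strict_ord ord mu nu.

End Multiindices.

Section PommaretBasis.
Variables (k : fieldType) (n : nat) (ord : rel 'X_{1..n}).
Local Notation P := {mpoly k[n]}.

(* The maximum of the support with respect to ord: 0%MM is the least element
   of a term order.  The value for f = 0 is irrelevant. *)
Definition lexp (f : P) : 'X_{1..n} :=
  \big[(fun mu nu => if ord mu nu then nu else mu)/0%MM]_(m <- msupp f) m.

Definition pcls (f : P) : nat := cls (lexp f).

Definition in_lexp_ideal (I : idealr P) (nu : 'X_{1..n}) : Prop :=
  exists f : P, [/\ f \in I, f != 0 & lexp f = nu].

Record pommaret_basis (I : idealr P) (H : seq P) : Prop := PommaretBasis {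
  pommaret_sub : {in H, forall h, h \in I /\ h != 0};
  pommaret_lexp_uniq : uniq [seq lexp h | h <- H];
  pommaret_cover : forall nu,
    in_lexp_ideal I nu <-> exists2 h, h \in H & pommaret_cone (lexp h) nu;
  pommaret_disjoint : {in H &, forall g h, g != h ->
    forall nu, ~ (pommaret_cone (lexp g) nu /\ pommaret_cone (lexp h) nu)} }.

(* A true minimum when H is not empty, since classes are at most n. *)
Definition min_cls (H : seq P) : nat := \big[minn/n]_(h <- H) pcls h.

End PommaretBasis.

(* Main.v *)
(* Write J_i = I + <x_1, ..., x_i>.  A Pommaret cone of class c is stable under
   division by x_j for j < c, since rho_j then absorbs the whole exponent of
   x_j.  As a class respecting order ranks monomials in <x_1, ..., x_i> below
   the others of the same degree, this gives (x_(i+1) f in J_i => f in J_i) for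
   all i + 1 < d, so x_1, ..., x_(d-1) is regular on P/I.  For i + 1 = d the
   implication still holds in degrees at least Q, the largest degree of an
   element of H of class d; writing one of degree Q as x_d g modulo
   <x_1, ..., x_(d-1)>, one gets that g is not in J_(d-1) but x_j g is for every j.

   Such a socle element bounds the length of any regular sequence s.  If s were
   longer than d - 1, its Koszul cohomology with values in P/I would vanish in
   degrees up to d - 1; passing to the quotient by a nonzerodivisor loses one
   degree, so H^0(s; P/J_(d-1)) would vanish, whereas g is in it. *)

Require Import Defs.
From Stdlib Require Import IndefiniteDescription.
From mathcomp Require Import all_boot all_order all_algebra.
From mathcomp.multinomials Require Import mpoly.
From mathcomp Require Import ring.

Set Implicit Arguments.
Unset Strict Implicit.
Unset Printing Implicit Defensive.

Import GRing.Theory.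
Local Open Scope ring_scope.

(** * Koszul cohomology modulo an ideal *)

Section Koszul.
Variable R : comNzRingType.
Implicit Types (N : R -> Prop) (b c : R) (s y : seq R) (f g : bitseq -> R)
  (t : bitseq).

Record is_ideal N : Prop := IsIdeal {
  is_ideal0 : N 0;
  is_idealD : forall b c, N b -> N c -> N (b + c);
  is_idealM : forall c b, N b -> N (c * b) }.

Lemma is_idealN N b : is_ideal N -> N b -> N (- b).
Proof. by move=> idN Nb; rewrite -mulN1r; apply: is_idealM. Qed.

Lemma is_idealB N b c : is_ideal N -> N b -> N c -> N (b - c).
Proof. by move=> idN Nb Nc; apply: is_idealD => //; apply: is_idealN. Qed.

(** The ideal N + (b); its iterate [adj N s] below is N + (s). *)
Definition adj1 N b c : Prop := exists a, N (c - a * b).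

Lemma is_ideal_adj1 N b : is_ideal N -> is_ideal (adj1 N b).
Proof.
move=> idN; split.
- by exists 0; rewrite mul0r subr0; apply: is_ideal0.
- move=> c1 c2 [a1 h1] [a2 h2]; exists (a1 + a2).
  have -> : c1 + c2 - (a1 + a2) * b = (c1 - a1 * b) + (c2 - a2 * b) by ring.
  exact: is_idealD.
- move=> c c1 [a1 h1]; exists (c * a1).
  have -> : c * c1 - c * a1 * b = c * (c1 - a1 * b) by ring.
  exact: is_idealM.
Qed.

Fixpoint adj N s : R -> Prop := if s is b :: s' then adj (adj1 N b) s' else N.

Lemma is_ideal_adj N s : is_ideal N -> is_ideal (adj N s).
Proof. by elim: s N => //= b s IHs N idN; apply: IHs; apply: is_ideal_adj1. Qed.

Lemma adj_rcons N s b : adj N (rcons s b) = adj1 (adj N s) b.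
Proof. by elim: s N => /=. Qed.

Lemma adjP N s c :
  adj N s c <-> exists a : 'I_(size s) -> R, N (c - \sum_i a i * s`_i).
Proof.
elim: s N => [|b s IHs] N /=.
  split=> [Nc|[a]]; last by rewrite big_ord0 subr0.
  by exists (fun=> 0); rewrite big_ord0 subr0.
rewrite IHs; split=> [[a [a0 h]]|[a]].
  exists (fun i : 'I_(size s).+1 => oapp a a0 (unlift ord0 i)).
  rewrite big_ord_recl unlift_none /= opprD addrA addrAC.
  by under eq_bigr do rewrite liftK.
rewrite big_ord_recl /= => h; exists (fun i => a (lift ord0 i)); exists (a ord0).
by rewrite addrAC -addrA -opprD.
Qed.

Definition nzdiv_mod N b : Prop := forall c, N (b * c) -> N c.

(** Weak regularity on R/N: N + (s) may be the unit ideal. *)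
Fixpoint reg N s : Prop :=
  if s is b :: s' then nzdiv_mod N b /\ reg (adj1 N b) s' else True.

Lemma regP N s :
  reg N s <-> forall i, (i < size s)%N -> nzdiv_mod (adj N (take i s)) s`_i.
Proof.
elim: s N => [|b s IHs] N //=; rewrite IHs.
split=> [[h0 h] [|i] //= /h //|h]; split; first exact: (h 0%N).
by move=> i; apply: (h i.+1).
Qed.

(* Cochains of the Koszul complex of s are functions on bit sequences: the
   component at t is the value at the subset of s selected by the mask t, so
   the degree of a component is [count id t]. Only masks t of size [size s]
   are meaningful. *)
Fixpoint kos s f t : R :=
  match s, t with
  | _ :: s', false :: t' => kos s' (fun u => f (false :: u)) t'
  | b :: s', true :: t' => b * f (false :: t') - kos s' (fun u => f (true :: u)) t'
  | _, _ => 0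
  end.

Lemma kos_linear s b c f g t :
  kos s (fun u => b * f u + c * g u) t = b * kos s f t + c * kos s g t.
Proof.
elim: s f g t => [|a s IHs] f g [|[] t] /=; rewrite ?mulr0 ?addr0 //.
by rewrite (IHs (fun u => f (true :: u)) (fun u => g (true :: u))); ring.
Qed.

Lemma eq_kos s f g t : f =1 g -> kos s f t = kos s g t.
Proof.
elim: s f g t => [|a s IHs] f g [|[] t] //= fg; last exact: IHs.
by rewrite fg (IHs _ (fun u => g (true :: u))).
Qed.

Lemma kosD s f g t : kos s (fun u => f u + g u) t = kos s f t + kos s g t.
Proof.
by rewrite -[kos s f t]mul1r -[kos s g t]mul1r -kos_linear; apply: eq_kos => u;
   rewrite !mul1r.
Qed.

Lemma kosZ s c f t : kos s (fun u => c * f u) t = c * kos s f t.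
Proof.
by rewrite -[RHS]addr0 -(mul0r (kos s f t)) -kos_linear; apply: eq_kos => u;
   rewrite mul0r addr0.
Qed.

Lemma kosN s f t : kos s (fun u => - f u) t = - kos s f t.
Proof. by rewrite -mulN1r -kosZ; apply: eq_kos => u; rewrite mulN1r. Qed.

Lemma kosB s f g t : kos s (fun u => f u - g u) t = kos s f t - kos s g t.
Proof. by rewrite -kosN -kosD. Qed.

Lemma kos_count0 s f t : count id t = 0%N -> kos s f t = 0.
Proof. by elim: s f t => [|b s IHs] f [|[] t] //=; rewrite add0n; apply: IHs. Qed.

Lemma kos_kos s f t : kos s (kos s f) t = 0.
Proof.
elim: s f t => [|b s IHs] f [|[] t] //=.
by rewrite kosB kosZ (IHs (fun u => f (true :: u))) subr0 subrr.
Qed.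

(** Vanishing of f as a cochain of degree i with values in R/N. *)
Definition cochain_in N s i f : Prop :=
  forall t, size t = size s -> count id t = i -> N (f t).

Lemma cochain_in_kos N s i f :
  is_ideal N -> cochain_in N s i f -> cochain_in N s i.+1 (kos s f).
Proof.
move=> idN; elim: s i f => [|b s IHs] i f Nf [|a t] //= [st].
case: a => /=; last first.
  rewrite add0n; apply: IHs => // u su cu.
  by apply: (Nf (false :: u)) => //=; rewrite su.
rewrite add1n => -[ct]; apply: is_idealB => //.
  by apply: is_idealM => //; apply: Nf => //=; rewrite st.
case: i ct Nf => [ct _|i ct Nf]; first by rewrite kos_count0 //; apply: is_ideal0.
apply: (IHs i) => // u su cu.
by apply: Nf => /=; rewrite ?su ?cu.
Qed.

(* H^i(s; R/N) = 0 *)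
Definition kos_acyclic N s i : Prop :=
  forall f, cochain_in N s i.+1 (kos s f) ->
  exists g, cochain_in N s i (fun t => f t - kos s g t).

Lemma cochain_in_adj1 N b s i f : is_ideal N -> cochain_in (adj1 N b) s i f ->
  exists g, cochain_in N s i (fun t => f t - b * g t).
Proof.
move=> idN Nf.
have /functional_choice[g hg] : forall t, exists a,
    size t = size s -> count id t = i -> N (f t - b * a).
  move=> t; case: (eqVneq (size t) (size s)) => [st|/eqP st]; last first.
    by exists 0 => /st.
  case: (eqVneq (count id t) i) => [ct|/eqP ct]; last by exists 0 => _ /ct.
  by have [a ha] := Nf t st ct; exists a; rewrite mulrC.
by exists g => t st ct; apply: hg.
Qed.

(** The complex of [b :: s] is a mapping cone of multiplication by b on that of s. Let x and y be
    the components of a cocycle without and with b, and d the differential for s. Modulo N, b x = d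
    y, so y is a cocycle modulo N + (b) and, by induction, y = d z + b w modulo N. Hence b (x - d w)
    lies in N, and b cancels. *)
Lemma reg_acyclic N s i :
  is_ideal N -> reg N s -> (i < size s)%N -> kos_acyclic N s i.
Proof.
elim: s N i => [|b s IHs] N i //= idN [nzb regs] lti f Nf.
set x := fun u => f (false :: u); set y := fun u => f (true :: u).
have Nx : cochain_in N s i.+1 (kos s x).
  by move=> t st ct; apply: (Nf (false :: t)) => /=; rewrite ?st.
have Nxy : cochain_in N s i (fun t => b * x t - kos s y t).
  by move=> t st ct; apply: (Nf (true :: t)) => /=; rewrite ?st ?ct.
(* In degree 0 the only component is x at the empty mask, and b x lies in N there. *)
case: i lti Nf Nx Nxy => [|i] lti Nf Nx Nxy.
  exists (fun=> 0) => -[|[] t] //= [st]; rewrite add0n => ct.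
  rewrite kos_count0 // subr0; apply: nzb.
  by have := Nxy t st ct; rewrite [kos s y t]kos_count0 // subr0.
have [z hz] : exists z, cochain_in (adj1 N b) s i (fun t => y t - kos s z t).
  apply: (IHs _ i) => //; first exact: is_ideal_adj1.
  move=> t st ct; exists (x t).
  rewrite -opprB mulrC; apply: is_idealN => //; exact: Nxy.
have [w hw] := cochain_in_adj1 idN hz.
pose g t := if t is a :: t' then if a then - z t' else w t' else 0.
exists g => -[|[] t] //= [st].
  rewrite add1n => -[ct]; rewrite kosN opprK opprD addrA addrAC.
  exact: hw.
rewrite add0n => ct; apply: nzb.
have -> : b * (f (false :: t) - kos s w t) = (b * x t - kos s y t)
    + kos s (fun u => (y u - kos s z u) - b * w u) t.
  by rewrite !kosB kosZ kos_kos /x; ring.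
apply: is_idealD => //; first exact: Nxy.
exact: (cochain_in_kos idN hw).
Qed.

(* The long exact sequence of 0 -> R/N -> R/N -> R/(N + (c)) -> 0, whose first
   map is multiplication by c. *)
Lemma acyclic_adj1 N c s i : is_ideal N -> nzdiv_mod N c ->
  kos_acyclic N s i -> kos_acyclic N s i.+1 -> kos_acyclic (adj1 N c) s i.
Proof.
move=> idN nzc ac0 ac1 f /(cochain_in_adj1 idN)[w hw].
have [g hg] : exists g, cochain_in N s i.+1 (fun t => w t - kos s g t).
  apply: ac1 => t st ct; apply: nzc.
  have /(_ t st ct) := cochain_in_kos idN hw.
  by rewrite kosB kosZ kos_kos sub0r => /(is_idealN idN); rewrite opprK.
have [z hz] : exists z, cochain_in N s i (fun t => (f t - c * g t) - kos s z t).
  apply: ac0 => t st ct; rewrite kosB kosZ.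
  have -> : kos s f t - c * kos s g t =
    (kos s f t - c * w t) + c * (w t - kos s g t) by ring.
  by apply: is_idealD => //; [apply: hw | apply: is_idealM => //; apply: hg].
exists z => t st ct; exists (g t).
have -> : f t - kos s z t - g t * c = f t - c * g t - kos s z t by ring.
exact: hz.
Qed.

Lemma acyclic_adj N y s i : is_ideal N -> reg N y ->
  (forall j, (j <= i + size y)%N -> kos_acyclic N s j) ->
  forall j, (j <= i)%N -> kos_acyclic (adj N y) s j.
Proof.
elim: y N i => [|c y IHy] N i /=.
  by move=> _ _ h j le_ji; apply: h; rewrite addn0.
move=> idN [nzc regy] h j le_ji; apply: (IHy _ i) => //.
  exact: is_ideal_adj1.
move=> l le_l; apply: acyclic_adj1 => //; apply: h; rewrite addnS //.
exact: leqW.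
Qed.

Lemma reg_size_le N y s u : is_ideal N -> reg N y -> reg N s ->
  {in s, forall c, adj N y (c * u)} -> ~ adj N y u -> (size s <= size y)%N.
Proof.
move=> idN regy regs su nu; rewrite leqNgt; apply/negP => lt_ys; apply: nu.
have idy := is_ideal_adj y idN.
(* The constant cochain u is a 0-cocycle modulo N + (y), since the entries of s multiply u into that
   ideal. No nonzero coboundary lives at the empty mask, so acyclicity in degree 0 puts u itself in
   N + (y). *)
have /(_ (fun=> u))[|g hg] : kos_acyclic (adj N y) s 0.
  apply: (@acyclic_adj N y s 0) => // j le_j.
  by apply: reg_acyclic => //; apply: leq_ltn_trans lt_ys.
- move=> t _ _; elim: s t su {regs lt_ys} => [|b s IHs] [|a t] //= su;
    try exact: is_ideal0.
  have IH := IHs t (fun c cs => su c (@mem_behead _ (b :: s) c cs)).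
  case: a => //; apply: is_idealB => //; apply: su; exact: mem_head.
have := hg (nseq (size s) false).
by rewrite size_nseq count_nseq kos_count0 ?count_nseq //= subr0; apply.
Qed.

End Koszul.

(** * Regular sequences on a quotient ring in terms of ideals *)

Section QuotientRegular.
Local Open Scope quotient_scope.
Variables (R : comNzRingType) (I : idealr R).
Implicit Types (s : seq R) (f : R).

Lemma is_ideal_idealr : is_ideal (fun f => f \in I).
Proof.
by split=> [|b c|c b]; [exact: idealr0 | exact: rpredD | exact: idealMr].
Qed.

Lemma quot_scaleE (a f : R) :
  a *: (\pi_{ideal_quot I} f) = \pi_{ideal_quot I} (a * f).
Proof. by rewrite [RHS]rmorphM. Qed.

Lemma in_seq_mul_quot s f :
  in_seq_mul s (\pi_{ideal_quot I} f) <-> adj (fun f => f \in I) s f.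
Proof.
rewrite adjP; split=> [[c hc]|[a ha]].
  exists (fun i => repr (c i)).
  rewrite Quotient.idealrBE; apply/eqP; rewrite hc rmorph_sum /=.
  apply: eq_bigr => i _; rewrite -[in LHS](reprK (c i)) quot_scaleE.
  by rewrite mulrC.
exists (fun i => \pi_{ideal_quot I} (a i)).
move: ha; rewrite Quotient.idealrBE => /eqP ->; rewrite rmorph_sum.
by apply: eq_bigr => i _; rewrite quot_scaleE mulrC.
Qed.

(** R/I is generated by the class of 1, so s generates a proper submodule exactly when 1 is not in I
    + (s). *)
Lemma regular_seq_quot s : regular_seq {ideal_quot I} s <->
  reg (fun f => f \in I) s /\ ~ adj (fun f => f \in I) s 1.
Proof.
rewrite regP /regular_seq; split=> -[h1 h2]; split.
- move=> i lti c hc; apply/in_seq_mul_quot; apply: h1 => //.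
  by rewrite quot_scaleE; apply/in_seq_mul_quot.
- move=> h; case: h2 => m; apply; rewrite -[m]reprK; apply/in_seq_mul_quot.
  rewrite -[repr m]mulr1; apply: is_idealM => //.
  exact/is_ideal_adj/is_ideal_idealr.
- move=> i lti m; rewrite -[m]reprK quot_scaleE => /in_seq_mul_quot h.
  by apply/in_seq_mul_quot; apply: h1.
- by exists (\pi_{ideal_quot I} 1) => /in_seq_mul_quot.
Qed.

End QuotientRegular.

(** * Monomials, classes and leading exponents *)

Lemma bigminn_le (T : eqType) (s : seq T) (Q : pred T) (F : T -> nat) x0 i :
  i \in s -> Q i -> (\big[minn/x0]_(j <- s | Q j) F j <= F i)%N.
Proof.
move=> + Qi; elim: s => // a s IHs; rewrite inE big_cons => /orP[/eqP<-|/IHs].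
  by rewrite Qi geq_minl.
by case: ifP => // _ le_i; rewrite geq_min le_i orbT.
Qed.

Lemma bigminn_mem (T : eqType) (s : seq T) (F : T -> nat) x0 :
  s != [::] -> {in s, forall i, (F i <= x0)%N} ->
  exists2 i, i \in s & \big[minn/x0]_(j <- s) F j = F i.
Proof.
elim: s => // a s IHs _ le_F; rewrite big_cons.
have [->|nz_s] := eqVneq s [::].
  by exists a; rewrite ?mem_head // big_nil; apply/minn_idPl/le_F/mem_head.
have [|i i_s ->] := IHs nz_s.
  by move=> i i_s; apply: le_F; rewrite inE i_s orbT.
have [le_a|lt_i] := leqP (F a) (F i).
  by exists a; rewrite ?mem_head.
by exists i => //; rewrite inE i_s orbT.
Qed.

Lemma exists_argmaxn (T : eqType) (s : seq T) (F : T -> nat) :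
  s != [::] -> exists2 i, i \in s & {in s, forall j, (F j <= F i)%N}.
Proof.
elim: s => // a s IHs _; have [->|nz_s] := eqVneq s [::].
  by exists a; rewrite ?mem_head // => j; rewrite inE => /eqP->.
have [i i_s le_i] := IHs nz_s.
have [le_a|/ltnW lt_a] := leqP (F a) (F i).
  by exists i => [|j]; rewrite inE ?i_s ?orbT // => /orP[/eqP->|/le_i].
exists a => [|j]; rewrite ?mem_head // inE => /orP[/eqP->//|/le_i le_j].
exact: leq_trans lt_a.
Qed.

Section Monomials.
Variables (k : fieldType) (n : nat).
Local Notation P := {mpoly k[n]}.
Implicit Types (f g h p : P) (m : 'X_{1..n}).

(** The degree bound makes the support finite. This serves to truncate polynomials and to divide
    them by a variable coefficientwise. *)
Lemma mpoly_of_coeff (E : 'X_{1..n} -> k) (b : nat) :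
  (forall m, (b <= mdeg m)%N -> E m = 0) -> exists p : P, forall m, p@_m = E m.
Proof.
move=> E0; exists (\sum_(m : 'X_{1..n < b}) E m *: 'X_[m]) => m.
case: (ltnP (mdeg m) b) => [lt_mb|le_bm]; first exact: mcoeff_mpoly.
rewrite E0 // raddf_sum big1 //= => -[m' lt_m'] _ /=.
rewrite mcoeffZ mcoeffX; case: eqP => [e|]; last by rewrite mulr0.
by move: lt_m'; rewrite e ltnNge le_bm.
Qed.

Lemma mcoeff_pihomog d f m :
  (pihomog mdeg d f)@_m = if mdeg m == d then f@_m else 0.
Proof.
rewrite pihomogE raddf_sum /=.
have [mf|mf] := boolP (m \in msupp f); last first.
  rewrite big1_seq ?(memN_msupp_eq0 mf) ?if_same // => m' /andP[_ m'f].
  rewrite mcoeffZ mcoeffX; case: eqP => [e|]; last by rewrite mulr0.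
  by rewrite -e m'f in mf.
rewrite -big_filter; case: ifP => dm; last first.
  rewrite big1_seq // => m' /andP[_]; rewrite mem_filter => /andP[dm' _].
  rewrite mcoeffZ mcoeffX; case: eqP => [e|]; last by rewrite mulr0.
  by rewrite -e dm' in dm.
rewrite (bigD1_seq m) ?mem_filter ?dm ?filter_uniq ?msupp_uniq //=.
rewrite mcoeffZ mcoeffX eqxx mulr1 big1 ?addr0 // => m' nm.
by rewrite mcoeffZ mcoeffX (negPf nm) mulr0.
Qed.

Lemma mcoeffMXi f (i : 'I_n) m :
  (f * 'X_i)@_m = if m i == 0%N then 0 else f@_(m - U_(i)).
Proof.
case: eqP => [mi|/eqP mi]; last first.
  have le_im : (U_(i) <= m)%MM by rewrite lep1mP.
  by rewrite -[in LHS](submK le_im) addmC mcoeffMX.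
apply: memN_msupp_eq0; rewrite (perm_mem (msuppMX _ _)).
apply/mapP=> -[m' _ e]; move: mi; rewrite e mnmDE mnm1E eqxx.
by [].
Qed.

Lemma pihomogMX d f (i : 'I_n) :
  pihomog mdeg d.+1 (f * 'X_i) = pihomog mdeg d f * 'X_i.
Proof.
apply/mpolyP => m; rewrite mcoeff_pihomog !mcoeffMXi mcoeff_pihomog.
case: (eqVneq (m i) 0%N) => [_|mi]; first by rewrite if_same.
have le_im : (U_(i) <= m)%MM by rewrite lep1mP.
have -> : mdeg m = (mdeg (m - U_(i))%MM).+1.
  by rewrite -[in LHS](submK le_im) mdegD mdeg1 addn1.
by rewrite eqSS.
Qed.

(** The monomial lies in the ideal of the first i variables; for nonzero m this means class at most
    i, see [lowE]. *)
Definition low (i : nat) m := [exists j : 'I_n, (j < i)%N && (m j != 0%N)].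

Lemma lowPn i m :
  reflect (forall j : 'I_n, (j < i)%N -> m j = 0%N) (~~ low i m).
Proof.
apply: (iffP existsPn) => h j; last first.
  by apply/negP => /andP[/h ->].
by move=> ji; apply/eqP; move: (h j); rewrite ji negbK.
Qed.

Lemma low0 i : ~~ low i 0%MM.
Proof. by apply/lowPn => j _; rewrite mnm0E. Qed.

Lemma lowD i m m' : low i (m + m')%MM = low i m || low i m'.
Proof.
apply/idP/orP => [/existsP[j /andP[ji]]|].
  rewrite mnmDE addn_eq0 negb_and => /orP[mj|mj]; [left|right];
  by apply/existsP; exists j; rewrite ji.
by case=> /existsP[j /andP[ji mj]]; apply/existsP; exists j;
  rewrite ji mnmDE addn_eq0 negb_and mj ?orbT.
Qed.

Lemma lowU i (j : 'I_n) : low i U_(j) = (j < i)%N.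
Proof.
apply/existsP/idP => [[l /andP[li]]|ji].
  by rewrite mnm1E; case: (eqVneq j l) => [->|].
by exists j; rewrite ji mnm1E eqxx.
Qed.

Lemma lowS (i : 'I_n) m : low i.+1 m = low i m || (m i != 0%N).
Proof.
apply/existsP/orP => [[j /andP[]]|[/existsP[j /andP[ji mj]]|mi]].
- rewrite ltnS leq_eqVlt => /orP[/eqP/val_inj->|ji mj]; first by right.
  by left; apply/existsP; exists j; rewrite ji.
- by exists j; rewrite mj leqW.
- by exists i; rewrite mi ltnSn.
Qed.

Lemma low_all i m : (n <= i)%N -> low i m = (m != 0%MM).
Proof.
move=> ni; apply/idP/idP => [|nz]; first by apply: contraTneq => ->; exact: low0.
apply: contraNT nz => /lowPn h; apply/eqP/mnmP => j; rewrite mnm0E h //.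
exact: leq_trans ni.
Qed.

Lemma cls_le m (i : 'I_n) : m i != 0%N -> (cls m <= i.+1)%N.
Proof.
move=> mi; rewrite /cls (@bigminn_le _ _ _ (fun j : 'I_n => j.+1)) //.
exact: mem_index_enum.
Qed.

Lemma cls_le_n m : (cls m <= n)%N.
Proof.
by rewrite /cls; elim/big_ind: _ => // x y hx _; rewrite geq_min hx.
Qed.

Lemma low_cls_le i m : low i m -> (cls m <= i)%N.
Proof. by case/existsP => j /andP[ji /cls_le] /leq_trans; apply. Qed.

Lemma cls_gt i m : (i < n)%N -> ~~ low i m -> (i < cls m)%N.
Proof.
move=> lt_in /lowPn h; rewrite /cls; elim/big_ind: _ => // [x y hx hy|j mj].
  by rewrite leq_min hx.
by rewrite ltnS leqNgt; apply: contra mj => /h ->.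
Qed.

Lemma lowE i m : m != 0%MM -> low i m = (cls m <= i)%N.
Proof.
move=> nz; apply/idP/idP; first exact: low_cls_le.
case: (ltnP i n) => [lt_in|/low_all->//].
by apply: contraLR => /(cls_gt lt_in); rewrite -ltnNge.
Qed.

Lemma gt_cls_eq0 (i : 'I_n) m : (i.+1 < cls m)%N -> m i = 0%N.
Proof.
by move=> h; apply/eqP; apply: contraLR h => /cls_le; rewrite -leqNgt.
Qed.

End Monomials.

Section LeadingExponent.
Variables (k : fieldType) (n : nat) (ord : rel 'X_{1..n}).
Hypotheses (tord : term_order ord) (crord : class_respecting ord).
Local Notation P := {mpoly k[n]}.
Implicit Types (f g h p : P) (m nu : 'X_{1..n}).

Lemma low_ord i m m' : mdeg m = mdeg m' -> low i m -> ~~ low i m' ->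
  strict_ord ord m m'.
Proof.
move=> dm lm lm'; apply: crord => //; case: (ltnP i n) => [lt_in|le_ni].
  exact: leq_ltn_trans (low_cls_le lm) (cls_gt lt_in lm').
(* For i at least n only 0 fails [low i], and no nonzero multi index has its degree. *)
move: lm lm'; rewrite !low_all // negbK => nz /eqP e.
by move: nz; rewrite -mdeg_eq0 dm e mdeg0.
Qed.

Lemma lexp_ub f m : m \in msupp f -> ord m (lexp ord f).
Proof.
rewrite /lexp; elim: (msupp f) => // a s IHs; rewrite inE big_cons.
set b := \big[_/_]_(i <- s) i in IHs *.
case/orP => [/eqP->|/IHs]; case: ifP => // ab.
- exact: term_order_refl.
- move=> mb; have /orP[|ba] := term_order_total tord a b; first by rewrite ab.
  exact: (term_order_trans tord mb).
Qed.

Lemma lexp_supp f : f != 0 -> lexp ord f \in msupp f.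
Proof.
rewrite -msupp_eq0 /lexp; elim: (msupp f) => // a s IHs _; rewrite big_cons.
case: s IHs => [_|b s IHs].
  (* The default 0 replaces a lone exponent a only if a is below 0, that is, a = 0. *)
  rewrite big_nil; case: ifP => [a0|_]; last exact: mem_head.
  rewrite inE; apply/eqP; apply: (term_order_anti tord).
  by rewrite a0 (term_order_ge0 tord).
by case: ifP => _; rewrite inE ?IHs ?orbT ?eqxx.
Qed.

Lemma lexpE f m :
  f@_m != 0 -> (forall m', f@_m' != 0 -> ord m' m) -> lexp ord f = m.
Proof.
move=> fm ub; have nz : f != 0 by apply: contraNneq fm => ->; rewrite mcoeff0.
apply: (term_order_anti tord).
rewrite ub -?mcoeff_msupp ?lexp_supp //=; apply: lexp_ub.
by rewrite mcoeff_msupp.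
Qed.

Lemma term_order_cancel m m' nu : ord (m + nu)%MM (m' + nu)%MM -> ord m m'.
Proof.
move=> h; have /orP[//|h'] := term_order_total tord m m'.
have e : (m + nu = m' + nu)%MM.
  by apply: (term_order_anti tord); rewrite h (term_order_add tord).
by move: h'; rewrite (addIm e).
Qed.

End LeadingExponent.

(** * The ideals generated by I and the first variables *)

Section VariableIdeals.
Variables (k : fieldType) (n : nat) (I : idealr {mpoly k[n]}).
Hypothesis homI : homog_ideal I.
Local Notation P := {mpoly k[n]}.
Implicit Types (f g h p : P) (m : 'X_{1..n}).

Definition vars i : seq P := [seq 'X_j | j <- take i (enum 'I_n)].

Lemma size_vars (i : 'I_n) : size (vars i) = i.
Proof. by rewrite size_map size_takel // size_enum_ord ltnW. Qed.

Lemma varsS (i : 'I_n) : vars i.+1 = rcons (vars i) 'X_i.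
Proof.
rewrite /vars (take_nth i) ?size_enum_ord // map_rcons.
by rewrite nth_ord_enum.
Qed.

(* Membership in I + <x_j : j < i>: the monomials of the second summand are
   exactly those satisfying [low i]. *)
Definition in_low_sum i f : Prop :=
  exists2 g, g \in I & forall m, ~~ low i m -> f@_m = g@_m.

Lemma adj_varsP i f : (i <= n)%N ->
  adj (fun h => h \in I) (vars i) f <-> in_low_sum i f.
Proof.
elim: i f => [|i IHi] f lt_in.
  rewrite /vars take0 /=; split=> [fI|[g gI fg]]; first by exists f.
  suff -> : f = g by [].
  by apply/mpolyP => m; apply: fg; apply/lowPn.
pose o := Ordinal lt_in; rewrite (varsS o) adj_rcons; split.
  case=> a /IHi[|g gI fg]; first exact: ltnW.
  exists g => // m; rewrite (lowS o) negb_or negbK => /andP[/fg <- /eqP mi].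
  by rewrite mcoeffB mcoeffMXi mi eqxx subr0.
case=> g gI fg.
(* q is the quotient by ['X_o] of the part of f - g whose monomials are divisible by ['X_o] but by
   no earlier variable. *)
have [|q hq] := @mpoly_of_coeff k n
    (fun m => if low i (m + U_(o))%MM then 0 else (f - g)@_(m + U_(o)))
    (msize (f - g)).
  move=> m hm; case: ifP => // _; apply/memN_msupp_eq0/msize_mdeg_ge.
  by rewrite mdegD (leq_trans hm) ?leq_addr.
exists q; apply/IHi; first exact: ltnW.
exists g => // m nlm; rewrite mcoeffB mcoeffMXi.
have [mi|mi] := eqVneq (m o) 0%N.
  by rewrite subr0 fg // (lowS o) negb_or nlm mi.
have le_om : (U_(o) <= m)%MM by rewrite lep1mP.
by rewrite hq submK // (negPf nlm) mcoeffB subKr.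
Qed.

Lemma is_ideal_low_sum i : (i <= n)%N -> is_ideal (in_low_sum i).
Proof.
move=> le_in; have idv := is_ideal_adj (vars i) (is_ideal_idealr I).
split=> [|b c|c b]; rewrite -!adj_varsP //.
- exact: is_ideal0.
- exact: is_idealD.
- exact: is_idealM.
Qed.

Lemma in_low_sum_I i f : f \in I -> in_low_sum i f.
Proof. by exists f. Qed.

Lemma in_low_sum_pihomog i d f :
  in_low_sum i f -> in_low_sum i (pihomog mdeg d f).
Proof.
case=> g gI fg; exists (pihomog mdeg d g); first exact: homI.
by move=> m /fg; rewrite !mcoeff_pihomog => ->.
Qed.

(** The constant term is a homogeneous component, hence in I; if nonzero, it would be a unit. *)
Lemma mcoeff0_ideal f : f \in I -> f@_0 = 0.
Proof.
move=> /(homI 0%N) fI; apply/eqP; apply: contraFT (idealr1 I) => nz.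
have -> : 1 = (f@_0)^-1%:MP * pihomog mdeg 0 f :> P.
  apply/mpolyP => m; rewrite mul_mpolyC mcoeffZ mcoeff_pihomog mcoeff1 mdeg_eq0.
  by case: (eqVneq m 0%MM) => [->|]; rewrite ?mulr0 ?mulVf.
exact: idealMr.
Qed.

Lemma low_sum_proper i : ~ in_low_sum i 1.
Proof.
case=> g /mcoeff0_ideal g0 /(_ 0%MM (low0 _ _)).
by rewrite g0 mcoeff1 eqxx => /eqP; rewrite oner_eq0.
Qed.

Variable ord : rel 'X_{1..n}.
Hypotheses (tord : term_order ord) (crord : class_respecting ord).
Local Notation inL := (in_lexp_ideal ord I).

(** The component of degree |m| keeps the leading exponent m. Homogeneous witnesses are needed
    because class respect compares monomials of equal degree only. *)
Lemma in_lexp_idealP m : inL m <-> exists h,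
  [/\ h \in I, h \is (mdeg m).-homog, h@_m != 0 & forall m', h@_m' != 0 -> ord m' m].
Proof.
split=> [[f [fI nz_f lexp_f]]|[h [hI _ hm ub]]]; last first.
  exists h; split=> //; first by apply: contraNneq hm => ->; rewrite mcoeff0.
  exact: lexpE.
have := lexp_supp tord nz_f; rewrite lexp_f mcoeff_msupp => fm.
exists (pihomog mdeg (mdeg m) f); split; first exact: homI.
- exact: pihomogP.
- by rewrite mcoeff_pihomog eqxx.
- move=> m'; rewrite mcoeff_pihomog; case: ifP => _; last by rewrite eqxx.
  by rewrite -mcoeff_msupp -lexp_f; apply: lexp_ub.
Qed.

(* Induction on the largest monomial of f outside <x_j : j < i>: by class
   respect it gives the leading exponent of any element of I congruent to
   f * x_i, hence can be cancelled against an element of I. *)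
Lemma homog_low_sum_divX (i : 'I_n) q :
  (forall m, mdeg m = q -> ~~ low i m -> inL (m + U_(i))%MM -> inL m) ->
  forall f, f \is q.-homog -> in_low_sum i (f * 'X_i) -> in_low_sum i f.
Proof.
move=> divL f.
(* The induction measure: the number of monomials of degree at most q that lie below some monomial
   of f outside <x_j : j < i>. *)
pose S f := [set m : 'X_{1..n < q.+1} |
  has (fun m' => ~~ low i m' && ord m m') (msupp f)].
have [c] := ubnP #|S f|; elim: c f => // c IHc f lt_c hom_f Jf.
have idJ := is_ideal_low_sum (ltnW (ltn_ord i)).
have [|f0 hf0] := @mpoly_of_coeff k n
    (fun m => if low i m then 0 else f@_m) (msize f).
  by move=> m hm; case: ifP => // _; apply/memN_msupp_eq0/msize_mdeg_ge.
have [f00|nz_f0] := eqVneq f0 0.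
  exists 0; first exact: idealr0.
  by move=> m nl; have := hf0 m; rewrite (negPf nl) f00 => <-.
pose m := lexp ord f0.
have ub m' : ~~ low i m' -> f@_m' != 0 -> ord m' m.
  by move=> nl fm'; apply: lexp_ub => //; rewrite mcoeff_msupp hf0 (negPf nl).
have [nlm fm] : ~~ low i m /\ f@_m != 0.
  have := lexp_supp tord nz_f0; rewrite mcoeff_msupp hf0 -/m.
  by case: ifP => // _; rewrite eqxx.
have dm : mdeg m = q by apply: (dhomog_mf hom_f); rewrite mcoeff_msupp.
have nlmi : ~~ low i (m + U_(i))%MM by rewrite lowD lowU ltnn orbF.
have : inL (m + U_(i))%MM.
  (* Outside <x_j : j < i> the component of g of degree q + 1 agrees with f * ['X_i]; its other
     monomials are smaller by class respect. So its leading exponent is m + U_(i). *)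
  have [g gI fg] := Jf.
  have dg m' : (pihomog mdeg q.+1 g)@_m' != 0 -> mdeg m' = q.+1.
    by rewrite mcoeff_pihomog; have [|_] := eqVneq (mdeg m') q.+1; rewrite ?eqxx.
  have eg m' : ~~ low i m' ->
      (pihomog mdeg q.+1 g)@_m' = if m' i == 0%N then 0 else f@_(m' - U_(i)).
    move=> nl; rewrite mcoeff_pihomog -fg // mcoeffMXi.
    have [_|mi] := eqVneq (m' i) 0%N; first by rewrite if_same.
    case: eqP => // dm'; apply/esym/(dhomog_nemf_coeff hom_f).
    apply: contra_not_neq dm' => dm'.
    have le_im : (U_(i) <= m')%MM by rewrite lep1mP.
    by rewrite -(submK le_im) mdegD mdeg1 dm' addn1.
  apply/in_lexp_idealP; exists (pihomog mdeg q.+1 g); split; first exact: homI.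
  - by rewrite mdegD dm mdeg1 addn1 pihomogP.
  - by rewrite eg // mnmDE mnm1E eqxx addn1 /= addmK.
  move=> m' gm'; have [lm'|nl] := boolP (low i m').
    have : strict_ord ord m' (m + U_(i))%MM.
      by apply: low_ord lm' nlmi => //; rewrite mdegD dm mdeg1 addn1 dg.
    by case/andP.
  move: gm'; rewrite eg //; have [_|mi] := eqVneq (m' i) 0%N; first by rewrite eqxx.
  have le_im : (U_(i) <= m')%MM by rewrite lep1mP.
  move=> fm'; rewrite -(submK le_im); apply: (term_order_add tord).
  apply: ub => //; apply: contra nl => l'.
  by rewrite -(submK le_im) lowD l'.
move=> /(divL m dm nlm)/in_lexp_idealP[h [hI hom_h hm ubh]].
pose f1 := f - (f@_m / h@_m) *: h.
have f1m : f1@_m = 0 by rewrite mcoeffB mcoeffZ divfK // subrr.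
have ub1 m' : ~~ low i m' -> f1@_m' != 0 -> ord m' m.
  move=> nl; rewrite mcoeffB mcoeffZ.
  have [->|/(ub _ nl)//] := eqVneq f@_m' 0.
  by rewrite sub0r oppr_eq0 mulf_eq0 negb_or => /andP[_ /ubh].
have hI' : (f@_m / h@_m) *: h \in I by rewrite -mul_mpolyC idealMr.
have -> : f = f1 + (f@_m / h@_m) *: h by rewrite subrK.
apply: is_idealD => //; last exact: in_low_sum_I.
apply: IHc.
- rewrite -ltnS (leq_trans _ lt_c) // ltnS; apply: proper_card.
  have lt_mq : (mdeg m < q.+1)%N by rewrite dm.
  (* Every monomial counted for f1 is below m, hence counted for f; m itself is counted for f but
     not for f1. *)
  apply/properP; split.
    apply/subsetP => m'; rewrite !inE => /hasP[m2 m2f /andP[nl2 m'm2]].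
    apply/hasP; exists m; rewrite ?mcoeff_msupp // nlm /=.
    by apply: (term_order_trans tord m'm2); apply: ub1 => //; rewrite -mcoeff_msupp.
  exists (BMultinom lt_mq); rewrite !inE /=.
    apply/hasP; exists m; rewrite ?mcoeff_msupp // nlm /=.
    exact: (term_order_refl tord).
  apply/hasPn => m2; rewrite mcoeff_msupp => m2f1; apply/negP => /andP[nl2 mm2].
  have e : m = m2 by apply: (term_order_anti tord); rewrite mm2 ub1.
  by rewrite -e f1m eqxx in m2f1.
- by rewrite rpredB // rpredZ // -dm.
- rewrite mulrBl; apply: is_idealB => //; apply: in_low_sum_I.
  by rewrite mulrC idealMr.
Qed.

(** J_i is homogeneous, so f can be treated one homogeneous component at a time. *)
Lemma low_sum_divX (i : 'I_n) :
  (forall m, ~~ low i m -> inL (m + U_(i))%MM -> inL m) ->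
  nzdiv_mod (in_low_sum i) 'X_i.
Proof.
move=> divL f; rewrite mulrC => Jf.
have idJ := is_ideal_low_sum (ltnW (ltn_ord i)).
rewrite (@pihomog_partitionE _ _ mdeg _ f (leqnn _)).
elim/big_ind: _ => [|b c|q _]; [exact: is_ideal0|exact: is_idealD|].
apply: (@homog_low_sum_divX i q); first by move=> m _; apply: divL.
  exact: pihomogP.
by rewrite -pihomogMX; apply: in_low_sum_pihomog.
Qed.

End VariableIdeals.

(** * Depth from a Pommaret basis *)

Section PommaretDepth.
Variables (k : fieldType) (n : nat) (I : idealr {mpoly k[n]}).
Variables (ord : rel 'X_{1..n}) (H : seq {mpoly k[n]}).
Hypotheses (homI : homog_ideal I) (tord : term_order ord)
  (crord : class_respecting ord) (PB : pommaret_basis ord I H)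
  (homH : {in H, forall h, exists d : nat, h \is d.-homog}).
Local Notation P := {mpoly k[n]}.
Implicit Types (f g h p : P) (m : 'X_{1..n}).
Local Notation inL := (in_lexp_ideal ord I).
Local Notation lexp := (lexp ord).

Lemma pommaret_nz h : h \in H -> h != 0.
Proof. by case/(pommaret_sub PB). Qed.

Lemma pommaret_in h : h \in H -> h \in I.
Proof. by case/(pommaret_sub PB). Qed.

Lemma mcoeff_lexp h : h \in H -> h@_(lexp h) != 0.
Proof. by move=> hH; rewrite -mcoeff_msupp lexp_supp // pommaret_nz. Qed.

Lemma pommaret_homog h : h \in H -> h \is (mdeg (lexp h)).-homog.
Proof.
move=> hH; have [d hd] := homH hH.
by rewrite (dhomog_mf hd) // lexp_supp // pommaret_nz.
Qed.

Lemma lexp_neq0 h : h \in H -> lexp h != 0%MM.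
Proof.
move=> hH; apply: contraTneq (mcoeff_lexp hH) => ->.
by rewrite (mcoeff0_ideal homI (pommaret_in hH)) eqxx.
Qed.

Lemma min_cls_le h : h \in H -> (min_cls ord H <= cls (lexp h))%N.
Proof. by move=> hH; apply: (@bigminn_le _ _ _ (pcls ord)). Qed.

(** When rho involves ['X_i], removing one factor from rho stays in the cone of h. *)
Lemma in_lexp_ideal_div (i : 'I_n) m :
  (exists h rho, [/\ h \in H, (m + U_(i))%MM = (lexp h + rho)%MM, rho i != 0%N &
     forall j : 'I_n, (cls (lexp h) < j.+1)%N -> rho j = 0%N]) -> inL m.
Proof.
case=> h [rho [hH e rho_i rho0]]; apply/(pommaret_cover PB); exists h => //.
have le_ir : (U_(i) <= rho)%MM by rewrite lep1mP.
exists (rho - U_(i))%MM; last by move=> j /rho0; rewrite mnmBE => ->.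
by apply: (@addIm _ U_(i)%MM); rewrite -addmA submK.
Qed.

Lemma lexp_div_low (i : 'I_n) m : (i.+1 < min_cls ord H)%N ->
  inL (m + U_(i))%MM -> inL m.
Proof.
move=> lt_i /(pommaret_cover PB)[h hH [rho e rho0]].
apply: (in_lexp_ideal_div (i := i)); exists h, rho; split=> //.
have := congr1 (fun m' : 'X_{1..n} => m' i) e.
rewrite !mnmDE mnm1E eqxx (@gt_cls_eq0 n i (lexp h)).
  by rewrite addn1 add0n => <-.
exact: leq_trans (min_cls_le hH).
Qed.

(** Division can fail only for h of class i + 1 with rho_i = 0. Then rho vanishes below i since m
    does, and above i by the cone condition. So m + U_(i) = lexp h would have degree q + 1, against
    the bound q. *)
Lemma lexp_div_top (i : 'I_n) q m : min_cls ord H = i.+1 ->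
  {in H, forall h, cls (lexp h) = i.+1 -> (mdeg (lexp h) <= q)%N} ->
  mdeg m = q -> ~~ low i m -> inL (m + U_(i))%MM -> inL m.
Proof.
move=> min_i le_q dm nlm /(pommaret_cover PB)[h hH [rho e rho0]].
apply: (in_lexp_ideal_div (i := i)); exists h, rho; split=> //.
have ei j : ((m + U_(i)) j = (lexp h + rho) j)%MM by rewrite e.
have := min_cls_le hH; rewrite min_i leq_eqVlt => /orP[/eqP cls_h|gt_h]; last first.
  have := ei i; rewrite !mnmDE mnm1E eqxx (gt_cls_eq0 gt_h).
  by rewrite addn1 add0n => <-.
apply/negP => /eqP rho_i0.
have rho_0 : rho = 0%MM.
  apply/mnmP => j; rewrite mnm0E.
  case: (ltngtP j i) => [ji|ij|/val_inj->//]; last first.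
    by apply: rho0; rewrite -cls_h.
  have := ei j; rewrite !mnmDE (lowPn _ _ nlm) // mnm1E.
  have -> : (i == j) = false by rewrite eq_sym -val_eqE /= ltn_eqF.
  by move/esym/eqP; rewrite addn_eq0 => /andP[_ /eqP].
have := le_q h hH (esym cls_h); move/(congr1 mdeg): e.
by rewrite rho_0 addm0 mdegD mdeg1 dm addn1 => <-; rewrite ltnn.
Qed.

Lemma reg_vars (i : 'I_n) : (i < min_cls ord H)%N ->
  reg (fun f => f \in I) (vars k n i).
Proof.
move=> lt_i; apply/regP => j; rewrite size_vars => lt_ji c.
have lt_jn : (j < n)%N := ltn_trans lt_ji (ltn_ord i).
have -> : (vars k n i)`_j = 'X_(Ordinal lt_jn).
  rewrite (nth_map i); last by rewrite size_takel ?size_enum_ord // ltnW.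
  rewrite nth_take //.
  by rewrite (nth_ord_enum i (Ordinal lt_jn)).
rewrite /vars -map_take take_takel 1?ltnW // !adj_varsP 1?ltnW //.
apply: (low_sum_divX homI tord crord (i := Ordinal lt_jn)) => m _.
by apply: lexp_div_low; apply: leq_ltn_trans lt_i.
Qed.

Lemma exists_socle (i : 'I_n) : H != [::] -> min_cls ord H = i.+1 ->
  exists2 g, ~ in_low_sum I i g &
    forall f, f@_0 = 0 -> in_low_sum I i (f * g).
Proof.
move=> nzH min_i.
have [h0 [h0H cls_h0 le_h0]] : exists h0, [/\ h0 \in H, cls (lexp h0) = i.+1 &
    {in H, forall h, cls (lexp h) = i.+1 -> (mdeg (lexp h) <= mdeg (lexp h0))%N}].
  pose A := [seq h <- H | cls (lexp h) == i.+1].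
  have nzA : A != [::].
    have [|h hH e] := @bigminn_mem _ H (pcls ord) n nzH.
      by move=> h _; apply: cls_le_n.
    have : h \in A by rewrite mem_filter hH andbT -min_i /min_cls e.
    by case: A.
  have [h] := exists_argmaxn (fun h => mdeg (lexp h)) nzA.
  rewrite mem_filter => /andP[/eqP cls_h hH] le_h.
  exists h; split=> // h1 h1H cls_h1; apply: le_h.
  by rewrite mem_filter cls_h1 eqxx.
have hom_h0 := pommaret_homog h0H; set Q := mdeg (lexp h0) in hom_h0 le_h0.
have Q_gt0 : (0 < Q)%N by rewrite lt0n mdeg_eq0 lexp_neq0.
have idJ := is_ideal_low_sum I (ltnW (ltn_ord i)).
(* g is h0 divided by ['X_i], after dropping the monomials in <x_j : j < i>. *)
have [|g hg] := @mpoly_of_coeff k n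
    (fun m => if low i m then 0 else h0@_(m + U_(i))) (msize h0).
  move=> m hm; case: ifP => // _; apply/memN_msupp_eq0/msize_mdeg_ge.
  by rewrite mdegD (leq_trans hm) ?leq_addr.
(* The leading exponent of h0 has class i + 1, and a monomial of the same degree failing [low i.+1]
   would exceed it. *)
have low_h0 m : h0@_m != 0 -> low i.+1 m.
  move=> hm; apply: contraTT (hm) => nlm.
  have dm : mdeg m = Q by rewrite (dhomog_mf hom_h0) // mcoeff_msupp.
  have lh0 : low i.+1 (lexp h0) by rewrite lowE ?lexp_neq0 // cls_h0.
  have /andP[ne le] := low_ord crord (esym dm) lh0 nlm.
  have ge : ord m (lexp h0) by apply: lexp_ub => //; rewrite mcoeff_msupp.
  by case/eqP: ne; apply: (term_order_anti tord); rewrite le ge.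
have hom_g : g \is (Q.-1).-homog.
  apply/dhomogP => m; rewrite mcoeff_msupp hg.
  case: ifP => [|_]; first by rewrite eqxx.
  rewrite -mcoeff_msupp => /(dhomog_mf hom_h0) /= <-.
  by rewrite mdegD mdeg1 addn1.
have Jgi : in_low_sum I i (g * 'X_i).
  exists h0; first exact: pommaret_in.
  move=> m nlm; rewrite mcoeffMXi; have [mi|mi] := eqVneq (m i) 0%N.
    apply/esym; apply: contraNeq nlm => /low_h0.
    by rewrite lowS mi eqxx orbF.
  have le_im : (U_(i) <= m)%MM by rewrite lep1mP.
  rewrite hg submK // ifN //; apply: contra nlm => l.
  by rewrite -(submK le_im) lowD l.
have Jgj (j : 'I_n) : in_low_sum I i ('X_j * g).
  (* ['X_j * g] has degree Q, and in this degree division by ['X_i] stays in J_i because Q is the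
     largest degree in class i + 1. *)
  apply: (@homog_low_sum_divX _ _ _ homI _ tord crord i Q).
  - by move=> m; apply: lexp_div_top.
  - rewrite -(prednK Q_gt0) -add1n; apply: dhomogM => //.
    by rewrite dhomogX /= mdeg1.
  - by rewrite -mulrA; apply: is_idealM.
exists g; last first.
  move=> f f0; rewrite [f]mpolyE mulr_suml.
  rewrite big_seq; elim/big_ind: _ => [|b c|m mf].
  - exact: is_ideal0.
  - exact: is_idealD.
  have : m != 0%MM.
    by apply: contraTneq mf => ->; rewrite mcoeff_msupp f0 eqxx.
  rewrite -(low_all _ (leqnn n)) => /existsP[j /andP[_ mj]].
  have le_jm : (U_(j) <= m)%MM by rewrite lep1mP.
  rewrite -(submK le_jm) mpolyXD scalerAl -mulrA.
  exact: is_idealM.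
case=> a aI ga.
(* If g were in J_i, nu would be a leading exponent of I: outside <x_j : j < i> the monomials of a
   are those of g, and adding U_(i) turns them into monomials of h0. *)
pose nu := (lexp h0 - U_(i))%MM.
have h0i : lexp h0 i != 0%N.
  by have := low_h0 _ (mcoeff_lexp h0H); rewrite lowS lowE ?lexp_neq0 // cls_h0 ltnn.
have le_ih : (U_(i) <= lexp h0)%MM by rewrite lep1mP.
have nu_h0 : (nu + U_(i) = lexp h0)%MM by rewrite submK.
have nl_nu : ~~ low i nu.
  have : ~~ low i (lexp h0) by rewrite lowE ?lexp_neq0 // cls_h0 ltnn.
  by apply: contra => l; rewrite -nu_h0 lowD l.
have g_nu : g@_nu != 0 by rewrite hg (negPf nl_nu) nu_h0 mcoeff_lexp.
have d_nu : mdeg nu = Q.-1 by rewrite (dhomog_mf hom_g) // mcoeff_msupp.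
have : inL nu.
  apply/in_lexp_idealP => //; exists (pihomog mdeg (mdeg nu) a); split.
  - exact: homI.
  - exact: pihomogP.
  - by rewrite mcoeff_pihomog eqxx -ga.
  move=> m; rewrite mcoeff_pihomog.
  have [dm am|_] := eqVneq (mdeg m) (mdeg nu); last by rewrite eqxx.
  have [lm|nlm] := boolP (low i m).
    by have /andP[] := low_ord crord dm lm nl_nu.
  apply: (term_order_cancel tord (nu := U_(i)%MM)); rewrite nu_h0.
  apply: lexp_ub => //; rewrite mcoeff_msupp.
  by move: am; rewrite -ga // hg (negPf nlm).
(* Every element of H has class at least i + 1, so the cone containing nu also contains nu + U_(i) =
   lexp h0. Disjointness forces h = h0, but nu has smaller degree than lexp h0. *)
case/(pommaret_cover PB) => h hH [rho e rho0].
have h0h : h0 = h.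
  apply/eqP; apply: contraT => ne.
  case: (pommaret_disjoint PB h0H hH ne (nu := lexp h0)); split.
    by exists 0%MM; rewrite ?addm0 // => j _; rewrite mnm0E.
  exists (rho + U_(i))%MM; first by rewrite addmA -e nu_h0.
  move=> j lt_j; rewrite mnmDE rho0 // mnm1E add0n.
  have le_i : (i.+1 <= cls (lexp h))%N by rewrite -min_i min_cls_le.
  have := leq_ltn_trans le_i lt_j; rewrite ltnS => lt_ij.
  by rewrite -val_eqE /= ltn_eqF.
have : (mdeg (lexp h0) <= mdeg nu)%N by rewrite h0h e mdegD leq_addr.
by rewrite -nu_h0 mdegD mdeg1 addn1 ltnn.
Qed.

Lemma pommaret_depth (i : 'I_n) : H != [::] -> min_cls ord H = i.+1 ->
  has_depth {ideal_quot I} i.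
Proof.
move=> nzH min_i; have le_in := ltnW (ltn_ord i).
have reg_i : reg (fun f => f \in I) (vars k n i).
  by apply: reg_vars; rewrite min_i.
split.
  exists (vars k n i); last exact: size_vars.
  split.
    apply/regular_seq_quot; split=> // /adj_varsP.
    by move/(_ le_in); apply: low_sum_proper.
  move=> f /mapP[j _ ->]; exists 1%N => //.
  by rewrite dhomogX /= mdeg1.
move=> s [/regular_seq_quot[reg_s _] hom_s].
have [g ng Jg] := exists_socle nzH min_i.
rewrite -(size_vars k i).
apply: (reg_size_le (is_ideal_idealr I) reg_i reg_s (u := g)).
  move=> c /hom_s[d d_gt0 hom_c]; apply/adj_varsP => //; apply: Jg.
  by apply: (dhomog_nemf_coeff hom_c); rewrite /= mdeg0 eq_sym -lt0n.
by move/adj_varsP => /(_ le_in).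
Qed.

End PommaretDepth.

(* An idealr is proper: it does not contain 1. *)
Theorem proposition3p16 (k : fieldType) (n : nat)
  (I : idealr {mpoly k[n]}) (ord : rel 'X_{1..n}) (H : seq {mpoly k[n]}) :
  homog_ideal I ->
  (exists2 f : {mpoly k[n]}, f \in I & f != 0) ->
  term_order ord -> class_respecting ord ->
  pommaret_basis ord I H ->
  {in H, forall h, exists d : nat, h \is d.-homog} ->
  has_depth {ideal_quot I} (min_cls ord H - 1)%N.
Proof.
move=> homI [f fI nz_f] tord crord PB homH.
have nzH : H != [::].
  have [+ _] := pommaret_cover PB (lexp ord f).
  by case=> [|h]; [exists f | case: (H)].
have [|h hH e] := @bigminn_mem _ H (pcls ord) n nzH.
  by move=> h _; apply: cls_le_n.
have nz_h := lexp_neq0 homI tord PB hH.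
have n_gt0 : (0 < n)%N.
  move: nz_h; rewrite -(low_all _ (leqnn n)) => /existsP[j _].
  exact: leq_ltn_trans (ltn_ord j).
(* Positivity of the class ensures that the natural number subtraction of 1 does not truncate. *)
have cls_gt0 : (0 < pcls ord h)%N.
  by apply: cls_gt => //; apply/lowPn.
have lt_n : ((pcls ord h).-1 < n)%N by rewrite prednK // cls_le_n.
have min_h : min_cls ord H = (Ordinal lt_n).+1 by rewrite /min_cls e /= prednK.
by rewrite min_h subn1; exact: (pommaret_depth homI tord crord PB homH nzH min_h).
Qed.
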